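(* For allocating contiguous blocks of indivisible chores to $n=2$ agents: the price of fairness with respect to egalitarian welfare equals $1$ both for MMS and for PROP1, i.e. $\mathrm{PoF}(\mathsf{EW},\mathrm{MMS})=\mathrm{PoF}(\mathsf{EW},\mathrm{PROP1})=1$; and the price of fairness with respect to utilitarian welfare equals $2$ both for MMS and for PROP1, i.e. $\mathrm{PoF}(\mathsf{UW},\mathrm{MMS})=\mathrm{PoF}(\mathsf{UW},\mathrm{PROP1})=2$.
   Context: A fair-chores instance $\mathcal I$ with two agents consists of agents $N=\{1,2\}$, indivisible items $E=\{e_1,\dots,e_m\}$ placed on a path in this order, and for each agent $i$ an additive valuation $v_i$ (i.e. $v_i(S)=\sum_{e\in S}v_i(e)$) with $v_i(e)\le 0$ for all $e\in E$, normalized so that $v_i(\emptyset)=0$, $v_i(E)=-1$. A bundle is connected if it is a set of consecutive items (the empty set is allowed). An allocation $\mathbf A=(A_1,A_2)$ is a partition of $E$ into two disjoint connected (possibly empty) bundles, $A_i$ being given to agent $i$ (either agent's bundle may be the left one). Its utilitarian welfare is $\mathsf{UW}(\mathbf A)=v_1(A_1)+v_2(A_2)$ and its egalitarian welfare is $\mathsf{EW}(\mathbf A)=\min\{v_1(A_1),v_2(A_2)\}$. The maximin share of agent $i$ is $\mathsf{MMS}_i=\max_{(X_1,X_2)}\min\{v_i(X_1),v_i(X_2)\}$ over all partitions of $E$ into two connected (possibly empty) bundles. An allocation is MMS if $v_i(A_i)\ge\mathsf{MMS}_i$ for both $i$. An allocation is PROP1 if for each $i$, either $v_i(A_i)\ge-\frac12$,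 or there is $e\in A_i$ such that $A_i\setminus\{e\}$ is connected and $v_i(A_i\setminus\{e\})\ge-\frac12$. For $W\in\{\mathsf{UW},\mathsf{EW}\}$ and $F\in\{\mathrm{MMS},\mathrm{PROP1}\}$, $\mathrm{PoF}(W,F)=\sup_{\mathcal I}\min_{\mathbf A}\frac{W(\mathbf A)}{\mathsf{OPT}_W(\mathcal I)}$, where $\mathsf{OPT}_W(\mathcal I)$ is the maximum of $W$ over all allocations of $\mathcal I$, the supremum is over all fair-chores instances with two agents, and the minimum is over all allocations $\mathbf A$ of $\mathcal I$ satisfying $F$; conventions: $c/0=+\infty$ for $c<0$ and $0/0=1$. *)

(* Defs.v *)
From HB Require Import structures.
From mathcomp Require Import all_classical all_reals ereal.
From mathcomp Require Import all_boot all_order all_algebra.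
Set Implicit Arguments.
Unset Strict Implicit.
Unset Printing Implicit Defensive.
Import Order.TTheory GRing.Theory Num.Theory.
Local Open Scope ring_scope.

(* Agents are the two elements [ord0] and [ord_max] of ['I_2]; the items of an
   instance are ['I_m], placed on the path in increasing order. *)
Record instance (R : realType) := Instance {
  nitems : nat;
  util : 'I_2 -> 'I_nitems -> R;
  util_le0 : forall i e, util i e <= 0;
  util_norm : forall i, \sum_e util i e = -1 }.

Definition val_of (R : realType) (I : instance R) (i : 'I_2)
    (S : {set 'I_(nitems I)}) : R :=
  \sum_(e in S) util i e.

Definition connected_bundle (m : nat) (S : {set 'I_m}) : bool :=
  [exists a : 'I_m.+1, exists b : 'I_m.+1,
     S == [set e : 'I_m | (a <= e < b)%N]].

(* Candidate pairs of bundles, [A i] being the bundle of agent [i]. *)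
Notation bundles m := {ffun 'I_2 -> {set 'I_m}}.

Definition is_allocation (m : nat) (A : bundles m) : bool :=
  [&& [forall i, connected_bundle (A i)],
      A ord0 :&: A ord_max == set0 &
      A ord0 :|: A ord_max == setT].

Definition all_to_first (m : nat) : bundles m :=
  [ffun i : 'I_2 => if i == ord0 then setT else set0].

Lemma all_to_first_allocation (m : nat) : is_allocation (all_to_first m).
Proof.
apply/and3P; split; rewrite ?ffunE /= ?setI0 ?setU0 //.
apply/forallP => i; rewrite ffunE; case: ifP => _.
  apply/existsP; exists ord0; apply/existsP; exists ord_max.
  by apply/eqP/setP => e; rewrite !inE ltn_ord.
apply/existsP; exists ord0; apply/existsP; exists ord0.
by apply/eqP/setP => e; rewrite !inE.
Qed.

(* The initial value of the iterated maximum is the value at an actual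
   allocation, so this is the true maximum of [f] over allocations. *)
Definition max_over_allocations (R : realType) (m : nat)
    (f : bundles m -> R) : R :=
  \big[Num.max/f (all_to_first m)]_(A : bundles m | is_allocation A) f A.

Lemma max_over_allocationsP (R : realType) (m : nat) (f : bundles m -> R) :
  (exists2 A, is_allocation A & f A = max_over_allocations f) /\
  (forall A, is_allocation A -> f A <= max_over_allocations f).
Proof.
split; last by move=> A hA; apply: le_bigmax_cond.
apply: (big_ind (fun x => exists2 A, is_allocation A & f A = x)).
- by exists (all_to_first m); rewrite ?all_to_first_allocation.
- by move=> x y hx hy; case: leP.
- by move=> A hA; exists A.
Qed.

Definition UW (R : realType) (I : instance R) (A : bundles (nitems I)) : R :=
  val_of ord0 (A ord0) + val_of ord_max (A ord_max).

Definition EW (R : realType) (I : instance R) (A : bundles (nitems I)) : R :=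
  Num.min (val_of ord0 (A ord0)) (val_of ord_max (A ord_max)).

Definition mms_share (R : realType) (I : instance R) (i : 'I_2) : R :=
  max_over_allocations (fun X : bundles (nitems I) =>
    Num.min (val_of i (X ord0)) (val_of i (X ord_max))).

Definition MMS (R : realType) (I : instance R) (A : bundles (nitems I)) : bool :=
  [forall i, mms_share I i <= val_of i (A i)].

Definition PROP1 (R : realType) (I : instance R) (A : bundles (nitems I)) :
    bool :=
  [forall i, (- 2^-1 <= val_of i (A i)) ||
     [exists e in A i, connected_bundle (A i :\ e) &&
                       (- 2^-1 <= val_of i (A i :\ e))]].

Definition welfare_ratio (R : realType) (c d : R) : \bar R :=
  if d == 0 then (if c == 0 then 1%E else +oo%E) else (c / d)%:E.

(* A minimum over no allocation at all would be [+oo]. *)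
Definition min_ratio (R : realType)
    (W : forall I : instance R, bundles (nitems I) -> R)
    (F : forall I : instance R, bundles (nitems I) -> bool)
    (I : instance R) : \bar R :=
  \big[mine/+oo%E]_(A : bundles (nitems I) | is_allocation A && F I A)
     welfare_ratio (W I A) (max_over_allocations (W I)).

Definition PoF (R : realType)
    (W : forall I : instance R, bundles (nitems I) -> R)
    (F : forall I : instance R, bundles (nitems I) -> bool) : \bar R :=
  ereal_sup (range (min_ratio W F)).

(* Main.v *)
(* Suppose an allocation A is unfair to agent i, in either sense. Then
   v_i(A_i) < -1/2, and agent i can cut the path so that both sides are fair to
   her and worth at least v_i(A_i); for PROP1 the cut is found by moving the cut
   of A into A_i, one item at a time, until just before i's side is worth at
   least -1/2. The other agent then chooses a side worth at least -1/2 to her,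
   which is fair in both senses. The resulting fair allocation has egalitarian
   welfare at least EW(A), and utilitarian welfare at least
   v_i(A_i) - 1/2 >= 2 v_i(A_i) >= 2 UW(A). Taking A optimal gives the upper
   bounds; a family of four-item instances shows that 2 is approached. *)
Require Import Defs.
From mathcomp Require Import all_classical all_reals ereal.
From mathcomp Require Import all_boot all_order all_algebra.
From mathcomp Require Import zify lra.
Import Order.TTheory GRing.Theory Num.Theory.
Set Implicit Arguments.
Unset Strict Implicit.
Unset Printing Implicit Defensive.
Local Open Scope ring_scope.

(** * Cuts of the path and two-agent allocations *)

Lemma ord2P (i : 'I_2) : i = ord0 \/ i = ord_max.
Proof. by case: i => -[|[|//]] ?; [left | right]; apply: val_inj. Qed.

Lemma ord2_neqP (i j k : 'I_2) : i != j -> k = i \/ k = j.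
Proof.
by case: (ord2P i) (ord2P j) (ord2P k) => -> [] -> [] -> //; auto.
Qed.

Lemma ord2_other (i : 'I_2) : exists j, i != j.
Proof. by case: (ord2P i) => ->; [exists ord_max | exists ord0]. Qed.

(* [S] and its complement form an allocation: one of them is a prefix. *)
Definition cut_set (m : nat) (S : {set 'I_m}) : bool :=
  connected_bundle S && connected_bundle (~: S).

Lemma cut_setC (m : nat) (S : {set 'I_m}) : cut_set (~: S) = cut_set S.
Proof. by rewrite /cut_set setCK andbC. Qed.

Lemma connected_bundleP (m : nat) (S : {set 'I_m}) :
  reflect (exists a b : nat, S = [set e : 'I_m | (a <= e < b)%N])
    (connected_bundle S).
Proof.
apply: (iffP existsP) => [[a /existsP[b /eqP ->]]|[a [b ->]]].
  by exists a, b.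
exists (inord (minn a m)); apply/existsP; exists (inord (minn b m)).
apply/eqP/setP => e; rewrite !inE !inordK ?ltnS ?geq_minr //.
by have := ltn_ord e; lia.
Qed.

Lemma cut_set_prefix (m k : nat) : cut_set [set e : 'I_m | (e < k)%N].
Proof.
apply/andP; split; apply/connected_bundleP.
  by exists 0%N, k; apply/setP => e; rewrite !inE.
by exists k, m; apply/setP => e; rewrite !inE ltn_ord andbT -leqNgt.
Qed.

(** The first item lies in [S] or in [~: S], and a connected bundle containing it is a prefix. The
    bound on [k] leaves finitely many cases for a fixed [m]. *)
Lemma cut_setP (m : nat) (S : {set 'I_m}) :
  reflect (exists2 k : nat, (k <= m)%N &
             S = [set e : 'I_m | (e < k)%N] \/ ~: S = [set e : 'I_m | (e < k)%N])
    (cut_set S).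
Proof.
apply: (iffP idP) => [|[k _ [] SE]]; last first.
- by rewrite -cut_setC SE cut_set_prefix.
- by rewrite SE cut_set_prefix.
have pre (T : {set 'I_m}) x : x \in T -> x = 0%N :> nat -> connected_bundle T ->
    exists2 k : nat, (k <= m)%N & T = [set e : 'I_m | (e < k)%N].
  move=> xT x0 /connected_bundleP[a [b TE]]; move: xT.
  rewrite TE inE x0 => /andP[a0 b0].
  exists (minn b m); first exact: geq_minr.
  by apply/setP => e; rewrite !inE; have := ltn_ord e; lia.
case/andP => cS cC.
case: (posnP m) => [m0|m_gt0].
  exists 0%N => //; left; apply/setP => e.
  by have := ltn_ord e; lia.
have [xS|xC] := boolP (Ordinal m_gt0 \in S).
  by have [k km ->] := pre _ _ xS erefl cS; exists k => //; left.
rewrite -in_setC in xC.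
by have [k km ->] := pre _ _ xC erefl cC; exists k => //; right.
Qed.

(** The item to drop is the one next to the cut: the last item of a prefix, the first item of a
    suffix. *)
Lemma cut_set_shrink (m : nat) (S : {set 'I_m}) :
  cut_set S -> S != set0 -> exists2 e, e \in S & cut_set (S :\ e).
Proof.
case/cut_setP => k km [] SE /set0Pn[x].
- rewrite SE inE => xk; have k1m : (k.-1 < m)%N by lia.
  exists (Ordinal k1m); first by rewrite inE /=; lia.
  rewrite [X in cut_set X](_ : _ = [set e : 'I_m | (e < k.-1)%N]) ?cut_set_prefix //.
  by apply/setP => e; rewrite !inE -val_eqE /=; lia.
- have {}SE : S = [set e : 'I_m | (k <= e)%N].
    by rewrite -[S]setCK SE; apply/setP => e; rewrite !inE -leqNgt.
  rewrite SE inE => xk; have k1m : (k < m)%N by have := ltn_ord x; lia.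
  exists (Ordinal k1m); first by rewrite inE /=.
  rewrite -cut_setC [X in cut_set X](_ : _ = [set e : 'I_m | (e < k.+1)%N]).
    exact: cut_set_prefix.
  by apply/setP => e; rewrite !inE -val_eqE /=; lia.
Qed.

Definition give (m : nat) (i : 'I_2) (S : {set 'I_m}) : bundles m :=
  [ffun k => if k == i then S else ~: S].

Lemma give_allocation (m : nat) (i : 'I_2) (S : {set 'I_m}) :
  is_allocation (give i S) = cut_set S.
Proof.
rewrite /is_allocation !ffunE.
have -> : [forall k, connected_bundle (give i S k)] = cut_set S.
  apply/forallP/andP => [cS|[cS cC] k]; last by rewrite ffunE; case: eqP.
  case: (ord2P i) (cS ord0) (cS ord_max) => -> /=; rewrite !ffunE //=.
by case: (ord2P i) => -> /=; rewrite ?setICr ?setUCr ?[_ :&: S]setIC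
  ?[_ :|: S]setUC ?setICr ?setUCr ?eqxx ?andbT.
Qed.

Lemma allocationC (m : nat) (A : bundles m) :
  is_allocation A -> A ord_max = ~: A ord0.
Proof.
case/and3P => _ /eqP AI /eqP AU; apply/setP => e.
move/setP: AI => /(_ e); move/setP: AU => /(_ e).
by rewrite !inE; case: (e \in A ord0); case: (e \in A ord_max).
Qed.

Lemma allocation_cut (m : nat) (i : 'I_2) (A : bundles m) :
  is_allocation A -> cut_set (A i).
Proof.
move=> aA; have /and3P[/forallP cA _ _] := aA.
have c0 : cut_set (A ord0) by rewrite /cut_set -allocationC // !cA.
by case: (ord2P i) => ->; rewrite ?(allocationC aA) ?cut_setC.
Qed.

(** * Maximin shares, repair of unfair allocations, and bounds on the ratio *)

Section Welfare.
Variables (R : realType) (I : instance R).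
Implicit Types (i j : 'I_2) (S : {set 'I_(nitems I)}) (A : bundles (nitems I)).

Lemma val_of_le0 i S : val_of i S <= 0.
Proof. by apply: sumr_le0 => e _; exact: util_le0. Qed.

Lemma val_ofC i S : val_of i S + val_of i (~: S) = -1.
Proof.
rewrite -(util_norm I i) (bigID (mem S)) /=; congr (_ + _).
by apply: eq_bigl => e; rewrite !inE.
Qed.

Lemma val_of_setD1 i S e : e \in S -> val_of i S <= val_of i (S :\ e).
Proof. by move=> eS; rewrite [val_of _ _](big_setD1 e eS) gerDr util_le0. Qed.

Lemma UWE i j A : i != j -> UW A = val_of i (A i) + val_of j (A j).
Proof. by case: (ord2P i) (ord2P j) => -> [] ->; rewrite /UW // addrC. Qed.

Lemma EWE i j A : i != j -> EW A = Num.min (val_of i (A i)) (val_of j (A j)).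
Proof. by case: (ord2P i) (ord2P j) => -> [] ->; rewrite /EW // minC. Qed.

Lemma mms_shareP i :
  exists2 S : {set 'I_(nitems I)}, cut_set S &
    mms_share I i = Num.min (val_of i S) (val_of i (~: S)).
Proof.
have [[X aX XE] _] := max_over_allocationsP (fun X : bundles (nitems I) =>
    Num.min (val_of i (X ord0)) (val_of i (X ord_max))).
exists (X ord0); first exact: allocation_cut.
by rewrite /mms_share -XE (allocationC aX).
Qed.

Lemma mms_share_ge i S : cut_set S ->
  Num.min (val_of i S) (val_of i (~: S)) <= mms_share I i.
Proof.
rewrite -(give_allocation ord0) => aS.
have [_ /(_ _ aS)] := max_over_allocationsP (fun X : bundles (nitems I) =>
    Num.min (val_of i (X ord0)) (val_of i (X ord_max))).
by rewrite !ffunE.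
Qed.

(** The two sides of a cut sum to -1. Hence a bundle worth at least one half of -1 is always
    MMS-fair. *)
Lemma mms_share_le_half i : mms_share I i <= - 2^-1.
Proof.
have [S _ ->] := mms_shareP i.
by have := val_ofC i S; rewrite ge_min; case: leP => //=; lra.
Qed.

(* The other agent takes a side that is worth at least [- 2^-1] to her. *)
Lemma cut_and_choose (fair : 'I_2 -> pred {set 'I_(nitems I)}) i S :
  (forall j T, - 2^-1 <= val_of j T -> fair j T) ->
  cut_set S -> fair i S -> fair i (~: S) ->
  exists B, [/\ is_allocation B, forall j, fair j (B j),
    Num.min (val_of i S) (val_of i (~: S)) <= val_of i (B i) &
    forall j, j != i -> - 2^-1 <= val_of j (B j)].
Proof.
move=> fair_half cS fS fC.
have choose T : cut_set T -> fair i T ->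
    Num.min (val_of i S) (val_of i (~: S)) <= val_of i T ->
    (forall j, j != i -> - 2^-1 <= val_of j (~: T)) ->
  exists B, [/\ is_allocation B, forall j, fair j (B j),
    Num.min (val_of i S) (val_of i (~: S)) <= val_of i (B i) &
    forall j, j != i -> - 2^-1 <= val_of j (B j)].
  move=> cT fT leT hT; exists (give i T); split=> [|j||j ji].
  - by rewrite give_allocation.
  - by rewrite ffunE; have [->//|/hT] := eqVneq j i; exact: fair_half.
  - by rewrite ffunE eqxx.
  - by rewrite ffunE (negPf ji); exact: hT.
have [j ij] := ord2_other i.
have [hj|hj] := leP (- 2^-1) (val_of j (~: S)).
  apply: (choose S) => //; first by rewrite ge_min lexx.
  by move=> k ki; case: (ord2_neqP k ij) ki => -> //; rewrite eqxx.
apply: (choose (~: S)); rewrite ?cut_setC //; first by rewrite ge_min lexx orbT.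
move=> k ki; case: (ord2_neqP k ij) ki => ->; rewrite ?eqxx // => _.
by rewrite setCK; have := val_ofC j S; lra.
Qed.

(** The interface between fairness and welfare: the upper bounds for both welfare notions use a
    fairness notion only through this property. *)
Definition fair_repair (F : forall I : instance R, bundles (nitems I) -> bool) :=
  forall A, is_allocation A -> ~~ F I A -> exists B i,
    [/\ is_allocation B, F I B, val_of i (A i) < - 2^-1,
        val_of i (A i) <= val_of i (B i) &
        forall j, j != i -> - 2^-1 <= val_of j (B j)].

(** Agent [i] cuts at a partition attaining her maximin share, so both sides are fair to her. *)
Lemma MMS_repair : fair_repair (@MMS R).
Proof.
move=> A aA; rewrite negb_forall => /existsP[i]; rewrite -ltNge => lti.
have half := mms_share_le_half.
have [S cS SE] := mms_shareP i.
case: (@cut_and_choose (fun j T => mms_share I j <= val_of j T) i S) => //.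
- by move=> j T; exact: le_trans.
- by rewrite SE ge_min lexx.
- by rewrite SE ge_min lexx orbT.
move=> B [aB fB leB hB]; exists B, i; split => //.
- exact/forallP.
- exact: lt_le_trans lti _.
- by rewrite -SE in leB; exact: le_trans (ltW lti) _.
Qed.

Lemma PROP1_repair : fair_repair (@PROP1 R).
Proof.
move=> A aA; rewrite negb_forall => /existsP[i].
rewrite negb_or -ltNge => /andP[lti _].
(* The lower bound ensures that [i] does not lose by moving from [A i] to [S]. *)
pose cand S := cut_set S && (val_of i (A i) <= val_of i S < - 2^-1).
have candA : cand (A i).
  by rewrite /cand lexx lti allocation_cut.
(* A smallest bundle that is still worse than one half becomes acceptable once
   its item at the cut is removed. *)
case: (arg_minnP (fun S : {set 'I_(nitems I)} => #|S|) candA).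
move=> S /and3P[cS leS ltS] minS.
have S0 : S != set0.
  by apply: contraTneq ltS => ->; rewrite -leNgt [val_of _ _]big_set0; lra.
have [e eS ce] := cut_set_shrink cS S0.
pose fair (j : 'I_2) (T : {set 'I_(nitems I)}) := (- 2^-1 <= val_of j T) ||
   [exists e in T, connected_bundle (T :\ e) && (- 2^-1 <= val_of j (T :\ e))].
have leC : - 2^-1 <= val_of i (~: S) by have := val_ofC i S; lra.
case: (@cut_and_choose fair i S) => //.
- by move=> j T hT; rewrite /fair hT.
- apply/orP; right; apply/existsP; exists e; rewrite eS /=.
  case/andP: (ce) => -> _ /=; rewrite leNgt; apply/negP => lte.
  have /minS : cand (S :\ e).
    by rewrite /cand ce lte andbT; exact: le_trans leS (val_of_setD1 _ eS).
  by rewrite (cardsD1 e S) eS add1n ltnn.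
- by rewrite /fair leC.
move=> B [aB fB leB hB]; exists B, i; split => //; first exact/forallP.
by apply: le_trans leB; rewrite le_min leS /=; lra.
Qed.

Lemma EW_le0 A : EW A <= 0.
Proof. by rewrite ge_min val_of_le0. Qed.

Lemma UW_le0 A : UW A <= 0.
Proof.
by have := (val_of_le0 ord0 (A ord0), val_of_le0 ord_max (A ord_max));
  rewrite /UW => -[]; lra.
Qed.

(** After a repair both agents have at least [val_of i (A i)], which is at least [EW A]. *)
Lemma EW_repair F A : fair_repair F -> is_allocation A ->
  exists B, [/\ is_allocation B, F I B & EW A <= EW B].
Proof.
move=> rF aA; have [fA|/(rF _ aA)] := boolP (F I A); first by exists A.
case=> [B [i [aB fB lti lei hB]]]; exists B; split => //.
have [j ij] := ord2_other i.
have hj : - 2^-1 <= val_of j (B j) by apply: hB; rewrite eq_sym.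
by rewrite !(EWE _ ij) le_min !ge_min lei /= (le_trans (ltW lti) hj).
Qed.

Lemma UW_repair F A : fair_repair F -> is_allocation A ->
  exists B, [/\ is_allocation B, F I B & 2 * UW A <= UW B].
Proof.
move=> rF aA; have [fA|/(rF _ aA)] := boolP (F I A).
  by exists A; split=> //; have := UW_le0 A; lra.
case=> [B [i [aB fB lti lei hB]]]; exists B; split => //.
have [j ij] := ord2_other i.
have hj : - 2^-1 <= val_of j (B j) by apply: hB; rewrite eq_sym.
by rewrite !(UWE _ ij); have := val_of_le0 j (A j); lra.
Qed.

Variable W : forall I : instance R, bundles (nitems I) -> R.
Variable F : forall I : instance R, bundles (nitems I) -> bool.
Hypothesis W_le0 : forall A, W A <= 0.

Lemma opt_le0 : max_over_allocations (@W I) <= 0.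
Proof. by have [[A _ <-] _] := max_over_allocationsP (@W I). Qed.

Lemma min_ratio_le c : 1 <= c ->
  (forall A, is_allocation A ->
     exists B : bundles (nitems I), [/\ is_allocation B, F B & c * W A <= W B]) ->
  (min_ratio W F I <= c%:E)%E.
Proof.
move=> c1 rF; have [[A aA AE] maxA] := max_over_allocationsP (@W I).
have [B [aB fB leB]] := rF _ aA.
apply: (@le_trans _ _ (welfare_ratio (W B) (max_over_allocations (@W I)))).
  by apply: bigmin_le_cond; rewrite aB.
rewrite AE in leB; rewrite /welfare_ratio.
have [d0|dN0] := eqVneq (max_over_allocations (@W I)) 0.
  (* A zero optimum forces [W B = 0], and the ratio 0/0 is 1. *)
  by rewrite d0 mulr0 in leB; rewrite eq_le W_le0 leB lee_fin.
by rewrite lee_fin ler_ndivrMr // lt_neqAle dN0 opt_le0.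
Qed.

Lemma min_ratio_ge (c : \bar R) :
  (forall A, is_allocation A -> F A ->
     (c <= welfare_ratio (W A) (max_over_allocations (@W I)))%E) ->
  (c <= min_ratio W F I)%E.
Proof.
move=> h; apply/bigmin_geP; split; first exact: leey.
by move=> A /andP[]; exact: h.
Qed.

Lemma welfare_ratio_ge1 A : is_allocation A ->
  (1 <= welfare_ratio (W A) (max_over_allocations (@W I)))%E.
Proof.
move=> aA; have [_ /(_ _ aA) le] := max_over_allocationsP (@W I).
rewrite /welfare_ratio; have [|dN0] := eqVneq _ 0.
  by case: ifP => // _ _; exact: leey.
by rewrite lee_fin ler_ndivlMr ?mul1r // lt_neqAle dN0 opt_le0.
Qed.

End Welfare.

(** * Instances whose utilitarian ratio approaches 2 *)

Section GapInstance.
Variables (R : realType) (d : R).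
Hypothesis d_bound : 0 < d < 8^-1.

(* Handing the first three items to the first agent costs [2^-1 + 2 * d] in
   total, but is unfair to that agent even after dropping an end item; every
   other allocation costs at least [1 - d]. *)
Definition gap_util (i : 'I_2) (e : 'I_4) : R :=
  nth 0 (if i == ord0 then [:: - d; - 2^-1; - d; 2 * d - 2^-1]
         else [:: 0; - 2^-1; - 2^-1; 0]) e.

Lemma gap_util_le0 i e : gap_util i e <= 0.
Proof.
case/andP: d_bound => d0 d8; rewrite /gap_util.
by case: ifP => _; case: e => -[|[|[|[|//]]]] ? /=; lra.
Qed.

Lemma gap_util_norm i : \sum_e gap_util i e = -1.
Proof. by rewrite !big_ord_recl big_ord0 /gap_util; case: ifP => _ /=; lra. Qed.

Definition gap_instance : instance R := Instance gap_util_le0 gap_util_norm.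

Definition gap_prefix (k : nat) : {set 'I_(nitems gap_instance)} :=
  [set e : 'I_4 | (e < k)%N].

Lemma gap_valE i (S : {set 'I_(nitems gap_instance)}) :
  val_of i S = \sum_(e < 4) if e \in S then gap_util i e else 0.
Proof. exact: big_mkcond. Qed.

(** Inspection of all cuts. The bound is attained when the second agent gets exactly the first one
    or two items. *)
Lemma gap_UW (A : bundles (nitems gap_instance)) : is_allocation A -> A ord0 != gap_prefix 3 ->
  UW A <= d - 1.
Proof.
case/andP: d_bound => d0 d8.
move=> aA; rewrite /UW (allocationC aA); have := allocation_cut ord0 aA.
have pre k (T : {set 'I_4}) : (k <= 4)%N -> T = [set e : 'I_4 | (e < k)%N] ->
    T = gap_prefix 0 \/ T = gap_prefix 1 \/ T = gap_prefix 2 \/ T = gap_prefix 3 \/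
    T = gap_prefix 4.
  by case: k => [|[|[|[|[|//]]]]] _ ->; rewrite -/(gap_prefix _); tauto.
rewrite !gap_valE !big_ord_recl !big_ord0 /gap_util /=.
move: (A ord0) => S /cut_setP[k k4 [] /(pre _ _ k4)].
  case=> [->|[->|[->|[->|->]]]]; rewrite ?eqxx // => _; rewrite !inE /=; lra.
move=> CE _; rewrite -(setCK S).
by case: CE => [->|[->|[->|[->|->]]]]; rewrite !inE /=; lra.
Qed.

Lemma gap_opt : - 2^-1 - 2 * d <= max_over_allocations (@UW R gap_instance).
Proof.
have aA : is_allocation (give ord0 (gap_prefix 3)).
  by rewrite give_allocation cut_set_prefix.
have [_ /(_ _ aA)] := max_over_allocationsP (@UW R gap_instance).
apply: le_trans.
rewrite /UW !gap_valE !big_ord_recl !big_ord0 /gap_util !ffunE /= !inE /=; lra.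
Qed.

(** Cutting after two items gives the first agent sides worth [- 2^-1 - d] and [d - 2^-1], both
    above [- 2^-1 - 2 * d]. *)
Lemma gap_not_MMS (A : bundles (nitems gap_instance)) :
  A ord0 = gap_prefix 3 -> ~~ MMS A.
Proof.
case/andP: d_bound => d0 d8 AE; apply/forallP => /(_ ord0); rewrite AE.
apply/negP; rewrite -ltNge.
have c2 : cut_set (gap_prefix 2) by exact: cut_set_prefix.
apply: lt_le_trans (mms_share_ge ord0 c2).
rewrite lt_min !gap_valE !big_ord_recl !big_ord0 /gap_util !inE /=.
by apply/andP; split; lra.
Qed.

(** Dropping an end item leaves [- 2^-1 - d], still too little; dropping the middle item disconnects
    the bundle. *)
Lemma gap_not_PROP1 (A : bundles (nitems gap_instance)) :
  A ord0 = gap_prefix 3 -> ~~ PROP1 A.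
Proof.
case/andP: d_bound => d0 d8 AE; apply/forallP => /(_ ord0); rewrite AE.
apply/negP; rewrite negb_or -ltNge; apply/andP; split.
  by rewrite !gap_valE !big_ord_recl !big_ord0 /gap_util !inE /=; lra.
rewrite negb_exists; apply/forallP => e; apply/negP => /and3P[].
rewrite inE => e3 /connected_bundleP[a [b]] /setP ab.
rewrite !gap_valE !big_ord_recl !big_ord0 /gap_util !inE /=.
case: e e3 ab => -[|[|[|//]]] he _ ab; rewrite -!val_eqE /=; try lra.
(* No interval contains items 0 and 2 but not item 1. *)
move: (ab ord0) (ab (inord 2)) (ab (inord 1)); rewrite !inE -!val_eqE /= !inordK //=.
lia.
Qed.

Lemma gap_min_ratio (F : forall I : instance R, bundles (nitems I) -> bool) :
  (forall A : bundles (nitems gap_instance), A ord0 = gap_prefix 3 -> ~~ F _ A) ->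
  ((2 - 10 * d)%:E <= min_ratio (@UW R) F gap_instance)%E.
Proof.
case/andP: d_bound => d0 d8 unfair; apply: min_ratio_ge => A aA fA.
have /(gap_UW aA) leA : A ord0 != gap_prefix 3.
  by apply: contraL fA => /eqP; exact: unfair.
have opt := gap_opt; have := opt_le0 (@UW_le0 R gap_instance); rewrite /welfare_ratio.
have [_|dN0 d_le0] := eqVneq _ 0.
  by move=> _; rewrite lt_eqF; [exact: leey | lra].
rewrite lee_fin ler_ndivlMr; last by rewrite lt_neqAle dN0.
(* The product of [2 - 10 * d] and [2^-1 + 2 * d] is [1 - d - 20 * d ^+ 2], at most [1 - d]; the
   first factor is positive because [d < 8^-1]. *)
by apply: le_trans leA _; nra.
Qed.

End GapInstance.

(** * The prices of fairness *)

Lemma PoF_EW (R : realType)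
    (F : forall I : instance R, bundles (nitems I) -> bool) :
  (forall I, @fair_repair R I F) -> PoF (@EW R) F = 1%E.
Proof.
move=> rF; apply/eqP; rewrite eq_le; apply/andP; split.
  apply: ge_ereal_sup => _ [I _ <-]; apply: min_ratio_le => //.
    exact: EW_le0.
  by move=> A aA; have [B hB] := EW_repair (rF I) aA; exists B; rewrite mul1r.
(* Every instance has ratio at least 1, so any single instance bounds the supremum from below. *)
have d16 : 0 < (16^-1 : R) < 8^-1 by lra.
apply: (@le_trans _ _ (min_ratio (@EW R) F (gap_instance d16))).
  by apply: min_ratio_ge => A aA _; apply: welfare_ratio_ge1 => //; exact: EW_le0.
by apply: ereal_sup_ubound; exists (gap_instance d16).
Qed.

Lemma PoF_UW (R : realType)
    (F : forall I : instance R, bundles (nitems I) -> bool) :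
  (forall I, @fair_repair R I F) ->
  (forall (d : R) (hd : 0 < d < 8^-1) (A : bundles (nitems (gap_instance hd))),
     A ord0 = gap_prefix hd 3 -> ~~ F _ A) ->
  PoF (@UW R) F = 2%:E.
Proof.
move=> rF gapF; apply/eqP; rewrite eq_le; apply/andP; split.
  apply: ge_ereal_sup => _ [I _ <-]; apply: min_ratio_le.
  - exact: UW_le0.
  - by rewrite ler1n.
  - by move=> A aA; exact: UW_repair (rF I) aA.
apply/lee_subgt0Pr => e e0.
(* The bound [e / 10] turns [2 - 10 * d] into at least [2 - e]; the cap [16^-1] keeps [d] in the
   admissible range. *)
have hd : 0 < Num.min (e / 10) 16^-1 < (8^-1 : R).
  rewrite lt_min gt_min divr_gt0 ?invr_gt0 ?ltr0n //=.
  by apply/orP; right; lra.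
apply: le_trans (ereal_sup_ubound (imageT _ (gap_instance hd))).
apply: le_trans (gap_min_ratio (gapF _ hd)).
rewrite -EFinB lee_fin.
by have : Num.min (e / 10) 16^-1 <= e / 10; [rewrite ge_min lexx | lra].
Qed.

Theorem theorem26 (R : realType) :
  (PoF (@EW R) (@MMS R) = 1%E /\ PoF (@EW R) (@PROP1 R) = 1%E) /\
  (PoF (@UW R) (@MMS R) = 2%:E /\ PoF (@UW R) (@PROP1 R) = 2%:E).
Proof.
split; split.
- by apply: PoF_EW => I; exact: MMS_repair.
- by apply: PoF_EW => I; exact: PROP1_repair.
- by apply: PoF_UW => [I|d hd A]; [exact: MMS_repair | exact: gap_not_MMS].
- by apply: PoF_UW => [I|d hd A]; [exact: PROP1_repair | exact: gap_not_PROP1].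
Qed.
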